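(* Let $X$ be a compact metric space and let $\phi$ be a continuous flow on $X$ with the standard shadowing property. If $\phi$ has zero topological entropy, then every non-trivial chain-recurrent class of $\phi$ is an irreducible almost heteroclinic set. Moreover, if a non-trivial chain-recurrent class contains no singularity, then it is minimal. In particular, if $\phi$ is a regular flow (that is, $\operatorname{Sing}(\phi)=\emptyset$), its chain-recurrent set is a disjoint union of minimal sets.
   Context: $(X,d)$ is a compact metric space, $\phi$ a continuous flow on $X$, $\mathcal O(x)$ the orbit of $x$, $\alpha(x),\omega(x)$ its limit sets. $\operatorname{Sing}(\phi)$ is the set of points (singularities) fixed by all $\phi_t$; other points are regular. The topological entropy of $\phi$ is that of the time-one map $\phi_1$. Pseudo-orbits and tracing. For $\delta,T>0$, a $\delta$-$T$-pseudo-orbit is a sequence $(x_i,t_i)_i$ indexed by an interval of integers (all of $\mathbb Z$ unless said to be finite) with $t_i\ge T$ and $d(\phi_{t_i}(x_i),x_{i+1})\le\delta$ for all consecutive indices. For a bi-infinite one put $S_0=0$, $S_i=\sum_{n=0}^{i-1}t_n$ for $i>0$, $S_i=-\sum_{n=1}^{|i|}t_{-n}$ for $i<0$. For $\varepsilon>0$, $\mathrm{Rep}(\varepsilon)$ is the set of increasing homeomorphisms $h:\mathbb R\to\mathbb R$ with $h(0)=0$ and $|\frac{h(t)-h(s)}{t-s}-1|\le\varepsilon$ for all $t\ne s$. A bi-infinite pseudo-orbit is strongly $\varepsilon$-traced by $x\in X$ if there is $h\in\mathrm{Rep}(\varepsilon)$ with $d(\phi_{t-S_i}(x_i),\phi_{h(t)}(x))\le\varepsilon$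 for all $i\in\mathbb Z$, $t\in[S_i,S_{i+1}]$. The flow has the standard shadowing property if for every $\varepsilon>0$ there is $\delta>0$ such that every $\delta$-$1$-pseudo-orbit is strongly $\varepsilon$-traced by some point of $X$. Chain recurrence. $y$ is chain-attainable from $x$ if for every $\delta>0$ there are $N\ge1$ and a finite $\delta$-$1$-pseudo-orbit $(x_i,t_i)_{i=0}^N$ with $x_0=x$, $x_N=y$. $CR(\phi)$ is the set of $x$ chain-attainable from themselves; the chain-recurrent classes are the equivalence classes of the relation on $CR(\phi)$ given by mutual chain-attainability. A compact invariant set $K$ is chain-transitive if for all $x,y\in K$ and every $\delta>0$ there is such a finite $\delta$-$1$-pseudo-orbit from $x$ to $y$ contained in $K$. A compact invariant set is non-trivial if it is not a single orbit and is not contained in $\operatorname{Sing}(\phi)$. It is minimal if each of its orbits is dense in it. The orbit $\mathcal O(x)$ of a regular point is a homoclinic loop if $\overline{\mathcal O(x)}=\mathcal O(x)\cup\{\sigma\}$ for some $\sigma\in\operatorname{Sing}(\phi)$; it is a heteroclinic connection if it is not a homoclinic loop and $\alpha(x)\cup\omega(x)\subset\operatorname{Sing}(\phi)$. A compact, invariant, chain-transitive set $\Lambda$ is almost heteroclinic if every regular point of $\Lambda$ whose orbit is not dense in $\Lambda$ lies on a heteroclinic connection. It is irreducible if it contains no proper non-trivial almost heteroclinic set. *)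

(* Defs.v *)
From mathcomp Require Import all_boot all_order all_algebra finmap.
From mathcomp Require Import all_classical all_reals all_analysis.

Set Implicit Arguments.
Unset Strict Implicit.
Unset Printing Implicit Defensive.

Import Order.TTheory GRing.Theory Num.Theory.
Import numFieldNormedType.Exports.

Local Open Scope classical_set_scope.
Local Open Scope ring_scope.

Section TopologicalEntropy.
Context {R : realType} {X : metricType R}.
Implicit Types (f : X -> X) (n : nat) (e : R).

Definition bowen_dist f n (x y : X) : R :=
  \big[Order.max/0]_(i < n) mdist (iter i f x) (iter i f y).

Definition bowen_separated f n e (E : {fset X}) : Prop :=
  forall x y, x \in E -> y \in E -> x != y -> e < bowen_dist f n x y.

(* This is (1/n) ln s(n, e), where s(n, e) is the largest cardinality of an
   (n, e)-separated set. Since [ln 0 = 0], it is 0 when X is empty. *)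
Definition separated_growth f n e : \bar R :=
  ereal_sup [set (ln (#|` E|%:R) / n%:R)%:E | E in bowen_separated f n e].

(* Bowen's definition; the limit exists in [\bar R] because the upper limit is
   a nonincreasing function of e. *)
Definition topological_entropy f : \bar R :=
  lim (limn_esup (fun n => separated_growth f n e) @[e --> 0^'+]).

End TopologicalEntropy.

Section Flows.
Context {R : realType} {X : metricType R}.
Implicit Types (phi : R -> X -> X) (K L : set X) (x y : X) (d e T : R).

Definition is_flow phi : Prop :=
  [/\ continuous (fun p : R * X => phi p.1 p.2),
      forall x, phi 0 x = x &
      forall s t x, phi (s + t) x = phi s (phi t x)].

Definition flow_entropy phi : \bar R := topological_entropy (phi 1).

Definition flow_orbit phi x : set X := range (phi ^~ x).

Definition Sing phi : set X := [set x | forall t, phi t x = x].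

Definition regular_point phi x : Prop := ~ Sing phi x.

Definition alpha_limit phi x : set X := cluster (phi t x @[t --> -oo]).

Definition omega_limit phi x : set X := cluster (phi t x @[t --> +oo]).

Definition flow_invariant phi K : Prop := forall t, phi t @` K = K.

(* A pseudo-orbit indexed by an interval [I] of integers; the values of [x] and
   [t] outside [I] are irrelevant. *)
Definition pseudo_orbit phi (I : set int) d T (x : int -> X) (t : int -> R) :
    Prop :=
  (forall i, I i -> T <= t i) /\
  (forall i, I i -> I (i + 1) -> mdist (phi (t i) (x i)) (x (i + 1)) <= d).

(* The times S_i of a bi-infinite pseudo-orbit; [Negz m] is -(m + 1). *)
Definition jump_time (t : int -> R) (i : int) : R :=
  match i with
  | Posz m => \sum_(0 <= n < m) t n%:Z
  | Negz m => - \sum_(1 <= n < m.+2) t (- n%:Z)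
  end.

Definition Rep e : set (R -> R) :=
  [set h : R -> R |
    [/\ {homo h : s t / s < t},
        continuous h /\
        (exists g : R -> R, [/\ cancel h g, cancel g h & continuous g]),
        h 0 = 0 &
        forall s t, t != s -> `|(h t - h s) / (t - s) - 1| <= e]].

Definition strongly_traced phi e (x : int -> X) (t : int -> R) (z : X) : Prop :=
  exists2 h, Rep e h &
    forall (i : int) (s : R), jump_time t i <= s <= jump_time t (i + 1) ->
      mdist (phi (s - jump_time t i) (x i)) (phi (h s) z) <= e.

Definition standard_shadowing phi : Prop :=
  forall e, 0 < e -> exists2 d, 0 < d &
    forall (x : int -> X) (t : int -> R),
      pseudo_orbit phi [set: int] d 1 x t ->
      exists z, strongly_traced phi e x t z.

Definition chain_in phi K d x y : Prop :=
  exists (N : nat) (xs : int -> X) (ts : int -> R),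
    [/\ (1 <= N)%N,
        pseudo_orbit phi [set i : int | 0 <= i <= N%:Z] d 1 xs ts,
        xs 0 = x, xs N%:Z = y &
        forall i : int, 0 <= i <= N%:Z -> K (xs i)].

Definition chain_attainable phi x y : Prop :=
  forall d, 0 < d -> chain_in phi [set: X] d x y.

Definition CR phi : set X := [set x | chain_attainable phi x x].

Definition chain_class phi : set (set X) :=
  [set C | exists2 x, CR phi x &
     C = [set y | [/\ CR phi y, chain_attainable phi x y &
                      chain_attainable phi y x]]].

Definition chain_transitive phi K : Prop :=
  forall x y, K x -> K y -> forall d, 0 < d -> chain_in phi K d x y.

Definition nontrivial phi K : Prop :=
  ~ (exists x, K = flow_orbit phi x) /\ ~ (K `<=` Sing phi).

Definition orbit_dense_in phi x K : Prop := K `<=` closure (flow_orbit phi x).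

Definition minimal_set phi K : Prop :=
  [/\ compact K, flow_invariant phi K & forall x, K x -> orbit_dense_in phi x K].

(* [homoclinic_loop phi x] and [heteroclinic_connection phi x] say that the
   orbit of x is such a loop, resp. connection. *)
Definition homoclinic_loop phi x : Prop :=
  regular_point phi x /\
  exists2 s, Sing phi s & closure (flow_orbit phi x) = flow_orbit phi x `|` [set s].

Definition heteroclinic_connection phi x : Prop :=
  [/\ regular_point phi x, ~ homoclinic_loop phi x &
      alpha_limit phi x `|` omega_limit phi x `<=` Sing phi].

Definition almost_heteroclinic phi L : Prop :=
  [/\ compact L, flow_invariant phi L, chain_transitive phi L &
      forall x, L x -> regular_point phi x -> ~ orbit_dense_in phi x L ->
        heteroclinic_connection phi x].

Definition irreducible_set phi L : Prop :=
  ~ exists K, [/\ K `<` L, nontrivial phi K & almost_heteroclinic phi K].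

End Flows.

(* Main.v *)
(* Every chain-recurrent class C, trivial or not, turns out to be minimal.
   Suppose that x and q lie in C but that the forward orbit of x eventually stays
   away from q.  Let k be an omega-limit point of x; it also lies in C.  There are
   pseudo-orbits q -> x and k -> q, of total length O(T), and arbitrarily long
   orbit pieces from x to a point near k.  Concatenating them yields closed
   pseudo-orbits through q that leave q for a time m_0 or m_1, with m_0 much larger
   than T and m_1 much larger than m_0.  Every binary word is thus written as a
   periodic pseudo-orbit; since the reparametrizations in Rep(1/2) distort waiting
   times by a factor at most 2, the word can be read off the tracing orbit.  So
   tracing orbits of distinct words are separated within a time linear in the
   length of the words, and the entropy is positive.  Hence C is the omega-limit
   set of each of its points. *)
Require Import Defs.
From mathcomp Require Import all_boot all_order all_algebra.
From mathcomp Require Import finmap ring lra zify.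
From mathcomp Require Import all_classical all_reals all_analysis.

Import Order.TTheory GRing.Theory Num.Theory.
Import numFieldNormedType.Exports.

Local Open Scope classical_set_scope.
Local Open Scope ring_scope.

(** * Positive entropy from exponentially many separated points *)

Section Entropy.
Context {R : realType} {X : metricType R}.
Implicit Types (f : X -> X) (n : nat) (e : R).

Lemma bowen_dist_xx f n (x : X) : bowen_dist f n x x = 0.
Proof.
rewrite /bowen_dist (eq_bigr (fun=> 0)) => [|i _]; last exact: mdistxx.
by elim/big_ind : _ => // a b -> ->; rewrite maxxx.
Qed.

Lemma bowen_dist_ge f n e (x y : X) (i : nat) : (i < n)%N ->
  bowen_dist f n x y <= e -> mdist (iter i f x) (iter i f y) <= e.
Proof.
by move=> i_lt; apply: le_trans; exact: (le_bigmax _ _ (Ordinal i_lt)).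
Qed.

Lemma separated_growth_ninc f n (d e : R) : d <= e ->
  (separated_growth f n e <= separated_growth f n d)%E.
Proof.
move=> de; apply: ereal_sup_le => _ /= [E sepE <-]; exists E => // x y xE yE xy.
exact: le_lt_trans de (sepE _ _ xE yE xy).
Qed.

Lemma limn_esup_mono (u v : nat -> \bar R) :
  (forall n, (u n <= v n)%E) -> (limn_esup u <= limn_esup v)%E.
Proof.
move=> uv; rewrite !limn_esup_lim; apply: lee_lim; try exact: is_cvg_esups.
near=> n; apply: ub_ereal_sup => _ /= [m nm <-].
by apply: le_trans (uv m) _; apply: ereal_sup_ubound; exists m.
Unshelve. all: by end_near. Qed.

Lemma limn_esup_ge_frequently (u : nat -> \bar R) (l : \bar R) :
  (forall N, exists2 n, (N <= n)%N & (l <= u n)%E) -> (l <= limn_esup u)%E.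
Proof.
move=> lu; rewrite limn_esup_lim; apply: lime_ge; first exact: is_cvg_esups.
near=> N; have [n Nn ln] := lu N.
by apply: le_trans ln _; apply: ereal_sup_ubound; exists n.
Unshelve. all: by end_near. Qed.

(** The points [z w] for the [2 ^ n] words of length n are separated at time [n.+1 * c]. As
    [n / n.+1 >= 1 / 2] for n > 0, the growth there is at least [ln 2 / (2 * c)], and the upper
    limit needs this bound only along these times. It passes to all scales below e, hence to the
    limit. *)
Lemma topological_entropy_gt0 f (e : R) (c : nat) (z : seq bool -> X) :
  0 < e -> (0 < c)%N ->
  (forall n w w', size w = n -> size w' = n -> w != w' ->
     e < bowen_dist f (n.+1 * c) (z w) (z w')) ->
  (0 < topological_entropy f)%E.
Proof.
move=> e0 c0 sep; set l := (ln 2 / (2 * c%:R))%:E : \bar R.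
have l0 : (0 < l)%E.
  by rewrite lte_fin divr_gt0 ?mulr_gt0 ?ltr0n// ln_gt0// ltr1n.
have growth n : (0 < n)%N -> (l <= separated_growth f (n.+1 * c) e)%E.
  move=> n0; set E := [fset z (val w) | w : n.-tuple bool]%fset.
  have sepE (w w' : n.-tuple bool) : w != w' ->
      e < bowen_dist f (n.+1 * c) (z w) (z w').
    by move=> ww'; apply: sep; rewrite ?size_tuple.
  have cE : #|` E| = (2 ^ n)%N.
    rewrite card_imfset /= ?size_enum_ord; last first.
      move=> w w' /= zw; apply/eqP/negPn/negP => /sepE.
      by rewrite zw bowen_dist_xx ltNge (ltW e0).
    by rewrite -cardE card_tuple card_bool.
  apply: le_trans; last first.
    apply: ereal_sup_ubound; exists E => //.
    move=> _ _ /imfsetP[w _ ->] /imfsetP[w' _ ->] zz; apply: sepE.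
    by apply: contra_neq zz => ->.
  rewrite cE lee_fin natrX lnXn ?ltr0n// ler_pdivrMr ?mulr_gt0 ?ltr0n//.
  rewrite mulrAC ler_pdivlMr ?ltr0n ?muln_gt0 ?c0//.
  rewrite (mulrnAl (ln 2)) -(mulrnAr (ln 2)) ler_pM2l ?ln_gt0 ?ltr1n//.
  by rewrite -natrM -mulrnA ler_nat; nia.
have F_ge : forall d, d <= e ->
    (l <= limn_esup (fun n => separated_growth f n d))%E.
  move=> d de; apply: limn_esup_ge_frequently => N.
  exists (N.+2 * c)%N; first by nia.
  by apply: le_trans (growth N.+1 _) (separated_growth_ninc _ _ _ _ de).
apply: (lt_le_trans l0); rewrite /topological_entropy; apply: lime_ge.
  apply: nonincreasing_at_right_is_cvge; near=> r => d d' _ _ dd'.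
  by apply: limn_esup_mono => n; exact: separated_growth_ninc.
near=> d; apply: F_ge; near: d; exact: nbhs_right_le.
Unshelve. all: by end_near. Qed.

End Entropy.

(** * Finite pseudo-orbits as lists, and their periodic repetition *)

Section OrbitPieces.
Context {R : realType} {X : metricType R}.
Variable phi : R -> X -> X.
Implicit Types (d e r t : R) (x y z : X) (s P : seq (X * R)).

(* A finite pseudo-orbit ending at y is stored as the list of its pieces
   (x_i, t_i), without the end point. *)
Definition start s y : X := (head (y, 1) s).1.

Fixpoint chain d s y : Prop :=
  if s is p :: s' then
    [/\ 1 <= p.2, mdist (phi p.2 p.1) (start s' y) <= d & chain d s' y]
  else True.

Definition duration s : R := \sum_(p <- s) p.2.

Lemma start_cat s1 s2 y : start (s1 ++ s2) y = start s1 (start s2 y).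
Proof. by case: s1. Qed.

Lemma chain_cat d s1 s2 y :
  chain d (s1 ++ s2) y <-> chain d s1 (start s2 y) /\ chain d s2 y.
Proof.
elim: s1 => [|p s1 IH] /=; first by split=> // -[].
rewrite start_cat; split=> [[? ? /IH[? ?]]|[[? ? ?] ?]]; split=> //.
exact/IH.
Qed.

(** The default piece [(y, 1)] stands for the end point, so the jump of the last piece, towards
    index [size s], is covered too. *)
Lemma chain_nth d s y i : chain d s y -> (i < size s)%N ->
  1 <= (nth (y, 1) s i).2 /\
  mdist (phi (nth (y, 1) s i).2 (nth (y, 1) s i).1) (nth (y, 1) s i.+1).1 <= d.
Proof.
elim: s i => // p s IH [|i] /= [p1 ps cs] i_lt; last exact: IH.
by split=> //; rewrite nth0.
Qed.

Lemma chain_le d e s y : d <= e -> chain d s y -> chain e s y.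
Proof.
move=> de; elim: s => //= p s IH [p1 ps /IH cs].
by split=> //; exact: le_trans ps de.
Qed.

Lemma duration_cat s1 s2 : duration (s1 ++ s2) = duration s1 + duration s2.
Proof. exact: big_cat. Qed.

Lemma duration_cons p s : duration (p :: s) = p.2 + duration s.
Proof. exact: big_cons. Qed.

Lemma chain_duration_ge0 d s y : chain d s y -> 0 <= duration s.
Proof.
elim: s => [|p s IH] /=; first by rewrite /duration big_nil.
by case=> p1 _ /IH s0; rewrite duration_cons; lra.
Qed.

Lemma chain_inP d x y : chain_in phi [set: X] d x y <->
  exists2 s, s != [::] /\ start s y = x & chain d s y.
Proof.
split=> [[N [xs [ts [N1 [ts1 jump] <- <- _]]]]|[s [s0 <-] cs]].
  pose piece (i : nat) := (xs i%:Z, ts i%:Z).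
  have piecesP k n : (k + n <= N)%N ->
      start [seq piece i | i <- iota k n] (xs (k + n)%N%:Z) = xs k%:Z /\
      chain d [seq piece i | i <- iota k n] (xs (k + n)%N%:Z).
    elim: n k => [|n IH] k kN /=; first by rewrite addn0.
    have [|IH1 IH2] := IH k.+1; first by rewrite addSnnS.
    rewrite -addSnnS IH1; split=> //; split=> //.
      by apply: ts1; rewrite /= lez_nat; lia.
    have := jump k%:Z; rewrite -PoszD addn1 /=; apply; rewrite ?lez_nat /=; lia.
  have [|<- ?] := piecesP 0 N; first by rewrite add0n.
  exists [seq piece i | i <- iota 0 N]; rewrite ?add0n//.
  by split=> //; case: (N) N1.
exists (size s), (fun i => (nth (y, 1) s (absz i)).1).
exists (fun i => (nth (y, 1) s (absz i)).2); split=> //.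
- by case: s0; case: (s).
- split=> [|] [] // i.
    (* [pseudo_orbit] also bounds the time at the last index [size s] from below; the default piece
       has time 1. *)
    rewrite /= lez_nat leq_eqVlt => /predU1P[->|]; first by rewrite nth_default.
    by move=> /(chain_nth _ _ _ _ cs)[].
  rewrite -PoszD addn1 /= !lez_nat => _ i_lt.
  by have [] := chain_nth _ _ _ _ cs i_lt.
- by rewrite nth_default.
Qed.

(** Shadowing concerns pseudo-orbits indexed by all integers, so a closed chain is repeated
    periodically. *)
Definition cyclic_piece P (p0 : X * R) (i : int) : X * R :=
  nth p0 P (absz (i %% (size P)%:Z)%Z).

Lemma cyclic_pseudo_orbit d p s : let P := p :: s in
  chain d P p.1 ->
  pseudo_orbit phi [set: int] d 1 (fun i => (cyclic_piece P p i).1)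
    (fun i => (cyclic_piece P p i).2).
Proof.
move=> P cP.
have E i : (absz (i %% (size P)%:Z)%Z < size P)%N.
  by rewrite -ltz_nat gez0_abs ?modz_ge0// ltz_pmod.
have step i := chain_nth _ _ _ _ cP (E i).
split=> i _ => [|_].
  by have [] := step i; rewrite (set_nth_default p) ?E.
have [_] := step i; rewrite (set_nth_default p) ?E// => jump.
rewrite {3}/cyclic_piece -modzDml -(gez0_abs (modz_ge0 i _))//.
rewrite -PoszD modz_nat absz_nat addn1.
(* From the last index the jump goes to the default point [p.1], which is also where piece 0
   starts. *)
have := E i; rewrite leq_eqVlt => /predU1P[sz|lt].
  by rewrite sz modnn; move: jump; rewrite sz [X in mdist _ X.1]nth_default.
by rewrite modn_small//; move: jump; rewrite [X in mdist _ X.1](set_nth_default p).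
Qed.

Lemma cyclic_jump_time P p i : (i <= size P)%N ->
  jump_time (fun i => (cyclic_piece P p i).2) i%:Z = duration (take i P).
Proof.
elim: i => [|i IH] i_le; first by rewrite take0 /duration big_nil /= big_geq.
rewrite (take_nth p)// -cats1 duration_cat -IH ?(ltnW i_le)//= big_nat_recr//=.
rewrite /duration big_seq1; congr (_ + _.2).
by rewrite /cyclic_piece modz_nat absz_nat modn_small.
Qed.

(** Only the first period of the repeated cycle is kept, and a piece is located by a splitting of
    the list: it begins at time [duration s1]. *)
Lemma cycle_traced d e p s :
    (forall xs ts, pseudo_orbit phi [set: int] d 1 xs ts ->
       exists z, strongly_traced phi e xs ts z) ->
    chain d (p :: s) p.1 ->
  exists z, exists2 h, Rep e h & forall s1 p' s2, p :: s = s1 ++ p' :: s2 ->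
    forall r, 0 <= r <= p'.2 ->
    mdist (phi r p'.1) (phi (h (duration s1 + r)) z) <= e.
Proof.
move=> shadow /cyclic_pseudo_orbit/shadow[z [h hR tr]]; exists z, h => // s1 p' s2.
set P := p :: s in tr * => PE r /andP[r0 rp].
have sz : (size s1 < size P)%N by rewrite PE size_cat /= -addSnnS leq_addr.
have cE : cyclic_piece P p (size s1)%:Z = p'.
  by rewrite /cyclic_piece modz_nat absz_nat modn_small// PE nth_cat ltnn subnn.
have := tr (size s1)%:Z (duration s1 + r).
rewrite -PoszD addn1 !cyclic_jump_time// 1?ltnW// (take_nth p)// -cats1.
have := cE; rewrite /cyclic_piece modz_nat absz_nat modn_small// => ->.
rewrite PE take_size_cat// duration_cat duration_cons /duration big_nil addr0.
rewrite addrAC subrr add0r; apply; lra.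
Qed.

End OrbitPieces.

(** * Limit points and chain recurrence *)

Section Recurrence.
Context {R : realType} {X : metricType R}.
Variable phi : R -> X -> X.
Hypotheses (X_compact : compact [set: X]) (phi_flow : is_flow phi).
Implicit Types (d e r t : R) (x y z : X) (s P : seq (X * R)).

Let phi0 x : phi 0 x = x. Proof. by have [_ ->] := phi_flow. Qed.
Let phiD r t x : phi (r + t) x = phi r (phi t x).
Proof. by have [_ _ ->] := phi_flow. Qed.

(** Compactness of [a, b] x X makes the local moduli of continuity uniform. *)
Lemma flow_equicontinuous a b e : 0 < e -> exists2 d, 0 < d &
  forall t x y, a <= t <= b -> mdist x y <= d -> mdist (phi t x) (phi t y) < e.
Proof.
move=> e0; have [cont _ _] := phi_flow.
have /compact_near_coveringP cpt : compact (`[a, b]%classic `*` [set: X]).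
  by apply: compact_setX => //; exact: segment_compact.
pose Q (d : R) (p : R * X) :=
  forall y, mdist p.2 y <= d -> mdist (phi p.1 p.2) (phi p.1 y) < e.
have := cpt R (0^'+) Q _.
case=> [[t x] /= _|d /= d0 equi].
  have e2 : 0 < e / 2 by rewrite divr_gt0.
  have := cont (t, x); move/metricType_numDomainType.cvgrPdist_lt => /(_ _ e2) /=.
  case=> -[A B] /= [/nbhs_ballP[r /= r0 rA] /nbhs_ballP[r' /= r'0 r'B]] AB.
  have close t' x' : ball t r t' -> ball x r' x' -> mdist (phi t x) (phi t' x') < e / 2.
    by move=> ta xb; apply: (AB (t', x')); split; [exact: rA|exact: r'B].
  have r'2 : 0 < r' / 2 by rewrite divr_gt0.
  exists ((ball t r `*` ball x (r' / 2)), [set d | d <= r' / 2]).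
    split; first by exists (ball t r, ball x (r' / 2)) => //; split; exact: nbhsx_ballx.
    exact: nbhs_right_le.
  move=> [[t' x'] d] /= [[ta xb] db] y x'y.
  have xx' : ball x r' x' by apply: le_ball xb; lra.
  have xy : ball x r' y.
    move: xb; rewrite !ballEmdist /= => xb.
    by apply: le_lt_trans (metric_triangle _ x' _) _; lra.
  apply: le_lt_trans (metric_triangle _ (phi t x) _) _.
  have := close _ _ ta xx'; have := close _ _ ta xy.
  by rewrite (metric_sym (phi t' x')); lra.
exists (d / 2); first by rewrite divr_gt0.
move=> t x y tab xy; apply: (equi (d / 2)) (t, x) _ y xy; rewrite /= ?divr_gt0//.
by rewrite sub0r normrN gtr0_norm ?divr_gt0//; lra.
Qed.

(** This says that y is an omega-limit point of x. *)
Definition returns x y := forall e t, 0 < e -> exists2 r, t <= r & mdist (phi r x) y < e.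

Lemma omega_nonempty x : exists y, returns x y.
Proof.
have [|y [_ cly]] := X_compact (phi n%:R x @[n --> \oo]) _; first exact: filterT.
exists y => e t e0.
have tail : \forall n \near \oo, t <= n%:R by exact: nbhs_infty_ger.
have [||_ [[n tn <-]]] := cly [set phi n%:R x | n in [set n | t <= n%:R]] (ball y e).
- by apply: filterS tail => n tn; exists n.
- exact: nbhsx_ballx.
- by rewrite ballEmdist /= metric_sym; exists n%:R.
Qed.

Lemma attainable_trans x y z : chain_attainable phi x y ->
  chain_attainable phi y z -> chain_attainable phi x z.
Proof.
move=> xy yz d d0; apply/chain_inP.
have /chain_inP[s1 [s10 <-] c1] := xy d d0.
have /chain_inP[s2 [s20 s2y] c2] := yz d d0.
exists (s1 ++ s2); last by apply/chain_cat; rewrite s2y.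
rewrite start_cat s2y; split=> //.
by case: (s1) s10.
Qed.

Lemma step_attainable x y t : 1 <= t -> phi t x = y -> chain_attainable phi x y.
Proof.
move=> t1 xy d d0; apply/chain_inP; exists [:: (x, t)] => //=.
by split; rewrite // xy mdistxx ltW.
Qed.

Lemma returns_attainable x y : returns x y -> chain_attainable phi x y.
Proof.
move=> xy d d0; apply/chain_inP; have [t t1 td] := xy d 1 d0.
by exists [:: (x, t)] => //=; split; rewrite // ltW.
Qed.

(* Removing one unit of time from a cycle through x: either one of its first two
   pieces lasts at least 2, or these two can be merged into a single one. *)
Lemma attainable_flow1 x : CR phi x -> chain_attainable phi (phi 1 x) x.
Proof.
move=> xCR d d0; apply/chain_inP.
have [|r r0 equi] := flow_equicontinuous 0 2 (d / 2); first lra.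
have [r' [r'0 r'r r'd]] : exists r', [/\ 0 < r', r' <= r & r' <= d / 2].
  by exists (Num.min r (d / 2)); rewrite lt_min !ge_min !lexx r0 orbT; split=> //; lra.
have [p1 [[|p2 s] [//= _ <- [t1 j1 [t2 j2 cs]]]]] : exists p1 s,
    [/\ s != [::], p1.1 = x & chain phi r' (p1 :: s) x].
  (* Running the cycle twice provides a second piece. *)
  have /chain_inP[[|p s] [// _ px] c] := xCR r' r'0.
  exists p, (s ++ p :: s); split=> //; first by case: (s).
  by rewrite -cat_cons; apply/chain_cat; rewrite px.
have cs' : chain phi d s p1.1 by apply: chain_le cs; lra.
have [t1_ge2|t1_lt2] := leP 2 p1.2.
  exists ((phi 1 p1.1, p1.2 - 1) :: p2 :: s) => //=; split=> //; first lra.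
    rewrite -phiD subrK; apply: le_trans j1 _; lra.
  by split=> //; lra.
have close t : 0 <= t <= 2 ->
    mdist (phi (p1.2 - 1 + t) (phi 1 p1.1)) (phi t p2.1) <= d / 2.
  move=> t02; rewrite -phiD [p1.2 - 1 + t + 1](_ : _ = t + p1.2); last by ring.
  by rewrite phiD ltW// equi//; apply: le_trans j1 _.
have [t2_ge2|t2_lt2] := leP 2 p2.2.
  exists ((phi 1 p1.1, p1.2 - 1 + 1) :: (phi 1 p2.1, p2.2 - 1) :: s) => //=.
  split; [lra | apply: le_trans (close 1 _) _; lra|]; split=> //; first lra.
  rewrite -phiD subrK; apply: le_trans j2 _; lra.
exists ((phi 1 p1.1, p1.2 - 1 + p2.2) :: s) => //=; split=> //; first lra.
apply: le_trans (metric_triangle _ (phi p2.2 p2.1) _) _.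
have := close p2.2; lra.
Qed.

Lemma attainable_flown x n : CR phi x -> chain_attainable phi (phi n%:R x) x.
Proof.
move=> xCR; elim: n => [|n IH]; first by rewrite phi0.
have yCR : CR phi (phi n%:R x).
  case: n IH => [|n] IH; first by rewrite phi0.
  apply: attainable_trans IH _; apply: step_attainable (erefl _).
  by rewrite ler1n.
apply: attainable_trans IH.
by rewrite -natr1 addrC phiD; exact: attainable_flow1.
Qed.

Lemma attainable_flow t x : CR phi x -> chain_attainable phi (phi t x) x.
Proof.
(* With n = truncn |t| + 2, the time n - t from [phi t x] to [phi n%:R x] is at least 1, as a piece
   requires. *)
move=> xCR; have := attainable_flown x (Num.truncn `|t|).+2 xCR.
apply: attainable_trans; apply: (step_attainable _ _ ((Num.truncn `|t|).+2%:R - t)).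
  have := truncnS_gt `|t|; rewrite -[_.+2%:R]natr1.
  have := ler_norm t; lra.
by rewrite -phiD subrK.
Qed.

(** If [phi t x] is close to y, then [phi 1 y] is close to [phi (1 + t) x], from which x is
    attainable. *)
Lemma returns_attainableV x y :
  CR phi x -> returns x y -> chain_attainable phi y x.
Proof.
move=> xCR xy d d0; have [r r0 equi] := flow_equicontinuous 0 1 d d0.
have [t _ txy] := xy r 0 r0.
have /chain_inP[s [s0 sx] cs] := attainable_flow (1 + t) x xCR d d0.
apply/chain_inP; exists ((y, 1) :: s) => //; rewrite /= sx; split=> //.
by rewrite phiD ltW// equi ?lexx ?ler01// metric_sym ltW.
Qed.

Lemma returns_flow t x y : returns x y -> returns x (phi t y).
Proof.
move=> xy e t1 e0; have [r r0 equi] := flow_equicontinuous t t e e0.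
have [r' r'_ge r'xy] := xy r (t1 - t) r0.
exists (t + r'); first by rewrite -lerBlDl.
by rewrite phiD equi ?lexx// ltW.
Qed.

Lemma closed_returns x : closed [set y | returns x y].
Proof.
move=> y cly e t e0; have e2 : 0 < e / 2 by rewrite divr_gt0.
have [z [xz]] := cly _ (nbhsx_ballx y _ e2).
rewrite ballEmdist /= => yz; have [r tr rz] := xz _ t e2; exists r => //.
by apply: le_lt_trans (metric_triangle _ z _) _; rewrite (metric_sym z); lra.
Qed.

Lemma returns_dense x y : returns x y -> closure (flow_orbit phi x) y.
Proof.
move=> xy B /nbhs_ballP[e /= e0 eB]; have [r _ rxy] := xy e 0 e0.
exists (phi r x); split; first by exists r.
by apply: eB; rewrite ballEmdist /= metric_sym.
Qed.

Lemma minimal_sub K C : minimal_set phi C -> compact K -> flow_invariant phi K ->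
  K `<=` C -> K !=set0 -> K = C.
Proof.
move=> [_ _ dense] cptK invK KC [x Kx]; apply/seteqP; split=> //.
apply: subset_trans (dense x (KC _ Kx)) _.
rewrite closureE; apply: smallest_sub.
  by apply: compact_closed cptK; exact: metric_hausdorff.
by move=> _ [t _ <-]; rewrite -(invK t); exists x.
Qed.

End Recurrence.

(** Difference quotients of h lie in [1/2, 3/2]; the factor 2 is a rounder bound. *)
Lemma Rep_bounds (R : realType) (e : R) (h : R -> R) (s t : R) :
  e <= 1 / 2 -> Rep e h -> s <= t -> (t - s) / 2 <= h t - h s <= 2 * (t - s).
Proof.
move=> e2 [_ _ _ slope]; rewrite le_eqVlt => /predU1P[->|st].
  by rewrite !subrr mul0r mulr0 lexx.
have := slope s t; rewrite gt_eqF// => /(_ isT); rewrite ler_distl => /andP[].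
rewrite ler_pdivlMr ?ler_pdivrMr ?subr_gt0// => lo hi.
have ts : 0 < t - s by rewrite subr_gt0.
by apply/andP; split; nra.
Qed.

Lemma first_difference (w w' : seq bool) : size w = size w' -> w != w' ->
  exists p b s s', w = p ++ b :: s /\ w' = p ++ ~~ b :: s'.
Proof.
elim: w w' => [|b w IH] [|b' w'] //= [szw]; have [<-|bb'] := eqVneq b b'.
  rewrite eqseq_cons eqxx /= => /(IH _ szw)[p [c [s [s' [-> ->]]]]].
  by exists (b :: p), c, s, s'.
move=> _; exists [::], b, w, w'; split=> //; congr cons.
by case: b b' bb' => [] [].
Qed.

(** * Recovering a word from the visits to q *)

Section Itineraries.
Context {R : realType} {X : metricType R}.
Variables (phi : R -> X -> X) (q : X) (eta T N : R) (ell : bool -> R).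
Implicit Types (z : X) (u : seq bool -> R) (w p : seq bool) (b : bool).

(* The orbit of z reads the word w: it is close to q at the times u w1, for w1 a
   proper prefix of w; the next letter b of w gives the waiting time up to the
   next visit, and the orbit stays away from q between the two visits. *)
Definition itinerary z u w : Prop := forall w1 b w2, w = w1 ++ b :: w2 ->
  [/\ 0 <= u w1 < N, mdist (phi (u w1) z) q <= eta,
      ell b / 2 <= u (rcons w1 b) - u w1 <= 2 * ell b &
      forall v, u w1 + 2 * T <= v <= u (rcons w1 b) - 2 * T ->
        4 * eta <= mdist (phi v z) q].

Hypotheses (eta_gt0 : 0 < eta) (ell_long : forall b, 8 * T <= ell b).

Definition shadows z z' : Prop :=
  forall v, 0 <= v < N -> mdist (phi v z) (phi v z') <= eta.

Lemma shadows_sym z z' : shadows z z' -> shadows z' z.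
Proof. by move=> zz' v /zz'; rewrite metric_sym. Qed.

(** Otherwise z is back at q while z' is still on its excursion; z' would then be both within 2 eta
    of q and at least 4 eta away. The letter c makes the return of z a recorded visit, since only
    proper prefixes are recorded. *)
Lemma itinerary_ahead z u z' u' p b c w b' w' :
    itinerary z u (p ++ b :: c :: w) -> itinerary z' u' (p ++ b' :: w') ->
    shadows z z' -> u' p <= u p + 2 * T ->
  u' (rcons p b') - 2 * T <= u (rcons p b).
Proof.
move=> zw zw' zz' sync; rewrite leNgt; apply/negP => ahead.
have [_ _ /andP[wait _] _] := zw _ _ _ erefl.
have [|uN near _ _] := zw (rcons p b) c w; first by rewrite cat_rcons.
have [_ _ _ far] := zw' _ _ _ erefl.
(* The excursion of z' is under way: [u' p + 2 * T <= u p + 4 * T], and z waits at least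
   [ell b / 2 >= 4 * T]. *)
have {}far : 4 * eta <= mdist (phi (u (rcons p b)) z') q.
  by apply: far; have := ell_long b; lra.
have := le_trans far (metric_triangle _ (phi (u (rcons p b)) z) _).
by have := shadows_sym _ _ zz' _ uN; move: eta_gt0; lra.
Qed.

(** The drift does not accumulate: along a common prefix, [itinerary_ahead] in both directions
    restores the bound 2T at each visit. *)
Lemma itinerary_sync z u z' u' p w w' : u [::] = 0 -> u' [::] = 0 -> 0 <= T ->
    w != [::] -> w' != [::] -> itinerary z u (p ++ w) ->
    itinerary z' u' (p ++ w') -> shadows z z' ->
  u' p - 2 * T <= u p <= u' p + 2 * T.
Proof.
move=> u0 u'0 T0; elim/last_ind: p w w' => [|p b IH] [|c w] [|c' w'] // _ _ zw zw' zz'.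
  by rewrite u0 u'0; lra.
rewrite !cat_rcons in zw zw'.
have /andP[lo hi] := IH (b :: c :: w) (b :: c' :: w') isT isT zw zw' zz'.
have lo' : u' p <= u p + 2 * T by lra.
have := itinerary_ahead _ _ _ _ _ _ _ _ _ _ zw zw' zz' lo'.
have := itinerary_ahead _ _ _ _ _ _ _ _ _ _ zw' zw (shadows_sym _ _ zz') hi.
lra.
Qed.

(** At the first difference, one orbit returns within [2 * ell false] and the other not before
    [ell true / 2]; up to the drift both returns must agree, which [gap] excludes. *)
Lemma itinerary_inj z u z' u' w w' :
    u [::] = 0 -> u' [::] = 0 -> 0 <= T ->
    8 * T + 4 * ell false < ell true ->
    size w = size w' -> itinerary z u (rcons w true) ->
    itinerary z' u' (rcons w' true) -> shadows z z' -> w = w'.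
Proof.
move=> u0 u'0 T0 gap szw zw zw' zz'; apply/eqP/negPn/negP => ww'.
wlog [p [s [s' [wE w'E]]]] : z u w z' u' w' u0 u'0 szw zw zw' zz' ww' /
    exists p s s', w = p ++ false :: s /\ w' = p ++ true :: s'.
  move=> wl; have [p [[] [s [s' [wE w'E]]]]] := first_difference _ _ szw ww'.
    apply: (wl z' u' w' z u w) => //; rewrite 1?eq_sym//; first exact: shadows_sym.
    by exists p, s', s.
  by apply: (wl z u w z' u' w') => //; exists p, s, s'.
(* The final [true] ensures that a letter follows the first difference, so that the return after it
   is a recorded visit. *)
have snoc r : exists c r', rcons r true = c :: r' :> seq bool.
  by case: r => [|c r']; [exists true, [::]|exists c, (rcons r' true)].
have [c [r rE]] := snoc s; have [c' [r' r'E]] := snoc s'.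
rewrite wE rcons_cat rcons_cons rE in zw.
rewrite w'E rcons_cat rcons_cons r'E in zw'.
have /andP[lo hi] :=
  itinerary_sync _ _ _ _ _ [:: _, _ & _] [:: _, _ & _] u0 u'0 T0 isT isT zw zw' zz'.
have sync : u' p <= u p + 2 * T by lra.
have := itinerary_ahead _ _ _ _ _ _ _ _ _ _ zw zw' zz' sync.
have [_ _ /andP[_ short] _] := zw _ _ _ erefl.
have [_ _ /andP[long _] _] := zw' _ _ _ erefl.
lra.
Qed.

End Itineraries.

(** * Coding words by closed pseudo-orbits *)

Section Horseshoe.
Context {R : realType} {X : metricType R}.
Variables (phi : R -> X -> X) (phi_flow : is_flow phi).
Variables (d e eta t0 : R) (x q : X) (A B : seq (X * R)) (m : bool -> R).
Hypotheses (A_neq0 : A != [::]) (startA : start A x = q).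
Hypotheses (chainA : chain phi d A x) (chainB : chain phi d B q).
Hypotheses (t0_ge0 : 0 <= t0) (m_ge1 : forall b, 1 <= m b).
Hypothesis jump : forall b, mdist (phi (m b) x) (start B q) <= d.
Hypothesis far : forall t, t0 <= t -> 5 * eta <= mdist (phi t x) q.
Hypotheses (e_le_eta : e <= eta) (e_le : e <= 1 / 2).

Definition excursion b : seq (X * R) := A ++ (x, m b) :: B.
Definition code (w : seq bool) : seq (X * R) := flatten [seq excursion b | b <- w].
Definition excursion_length b : R := duration A + m b + duration B.
(** This bounds the part of an excursion without control of the distance to q: both connecting
    chains and the initial time [t0] along the orbit of x. *)
Definition overhead : R := duration A + t0 + duration B.

Lemma code_chain w : start (code w) q = q /\ chain phi d (code w) q.
Proof.
elim: w => //= b w [IH1 IH2]; rewrite /code /= /excursion -!catA.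
rewrite start_cat /= startA; split=> //.
apply/chain_cat; split=> //=; rewrite start_cat IH1; split=> //.
by apply/chain_cat; rewrite IH1.
Qed.

Lemma code_neq0 w : w != [::] -> code w != [::].
Proof. by case: w => // b w _; rewrite /code /= /excursion; case: A. Qed.

Lemma duration_excursion b : duration (excursion b) = excursion_length b.
Proof. by rewrite /excursion duration_cat duration_cons /= addrA. Qed.

Lemma duration_code_rcons w b :
  duration (code (rcons w b)) = duration (code w) + excursion_length b.
Proof.
by rewrite /code map_rcons flatten_rcons duration_cat duration_excursion.
Qed.

Lemma excursion_length_ge0 b : 0 <= excursion_length b.
Proof.
have := chain_duration_ge0 _ _ _ _ chainA; have := chain_duration_ge0 _ _ _ _ chainB.
by rewrite /excursion_length; have := m_ge1 b; lra.
Qed.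

Lemma duration_code_le w L : (forall b, excursion_length b <= L) ->
  0 <= duration (code w) <= L *+ size w.
Proof.
move=> lenL; elim/last_ind: w => [|w b /andP[IH1 IH2]].
  by rewrite /duration big_nil lexx.
rewrite duration_code_rcons size_rcons mulrSr lerD// addr_ge0//.
exact: excursion_length_ge0.
Qed.

(** The visits are the images under h of the times at which the excursions begin. The margins 2T
    absorb the stretching of the overhead by h, so that between them the orbit traces x after time
    [t0]. *)
Lemma coded_itinerary z h w (L N : R) : Rep e h ->
    (forall s1 p s2, code w = s1 ++ p :: s2 -> forall r, 0 <= r <= p.2 ->
       mdist (phi r p.1) (phi (h (duration s1 + r)) z) <= e) ->
    (forall b, excursion_length b <= L) -> 2 * (L *+ size w) <= N ->
  itinerary phi q eta overhead N excursion_length z (h \o duration \o code) w.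
Proof.
move=> hR tr lenL LN w1 b w2 wE.
have [_ phi0 _] := phi_flow.
have [h_incr [_ [g [gK hK _]]] h0 _] := hR.
have codeE : code w = code w1 ++ A ++ (x, m b) :: (B ++ code w2).
  by rewrite wE /code map_cat flatten_cat /= /excursion -!catA.
have dA := chain_duration_ge0 _ _ _ _ chainA.
have dB := chain_duration_ge0 _ _ _ _ chainB.
have /andP[tau_ge0 tau_le] := duration_code_le w1 L lenL.
have len0 := excursion_length_ge0 b.
have ovh0 : 0 <= overhead by rewrite !addr_ge0.
have := duration_code_rcons w1 b; set tau := duration (code w1) in tau_ge0 tau_le *.
rewrite /= -/tau; set tau' := duration _ => tau'E.
have tau'_gt : tau <= tau' by lra.
split.
(* Only proper prefixes count, so one length L is left to spare and the visit comes strictly before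
   N. *)
- have /andP[lo hi] := Rep_bounds _ _ _ _ _ e_le hR tau_ge0.
  have Llt : L *+ size w1 + L <= L *+ size w.
    rewrite -mulrSr wE size_cat /= addnS -addSn mulrnDr lerDl mulrn_wge0//.
    exact: le_trans len0 (lenL b).
  have L0 : 0 < L.
    apply: lt_le_trans (lenL b); rewrite /excursion_length.
    by have := m_ge1 b; lra.
  by apply/andP; rewrite h0 in lo hi; split; lra.
- case: A A_neq0 startA chainA codeE => // a A' _ <- [a1 _ _] codeE.
  have := tr _ _ _ codeE 0; rewrite addr0 phi0 metric_sym => near.
  by apply: le_trans e_le_eta; apply: near; rewrite lexx (le_trans ler01).
- have := Rep_bounds _ _ _ _ _ e_le hR tau'_gt; lra.
- move=> v /andP[v_ge v_le].
  (* The time v is pulled back by the inverse g of h; the next two facts place [g v] in the piece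
     starting at x, at least [t0] after its beginning. *)
  have r_ge : t0 <= g v - (tau + duration A).
    rewrite leNgt; apply/negP => r_lt.
    have /h_incr : g v < tau + overhead by rewrite /overhead; lra.
    have /(Rep_bounds _ _ _ _ _ e_le hR) : tau <= tau + overhead by rewrite lerDl.
    by rewrite hK; lra.
  have r_le : g v - (tau + duration A) <= m b.
    rewrite leNgt; apply/negP => r_gt.
    have /h_incr : tau' - duration B < g v.
      by rewrite tau'E /excursion_length; lra.
    have /(Rep_bounds _ _ _ _ _ e_le hR) : tau' - duration B <= tau'.
      by rewrite gerBl.
    by rewrite hK; move: v_le t0_ge0; rewrite /overhead; lra.
  have codeE' : code w = (code w1 ++ A) ++ (x, m b) :: (B ++ code w2).
    by rewrite codeE catA.
  have := tr _ _ _ codeE' (g v - (tau + duration A)).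
  rewrite /= duration_cat -/tau [_ + (g v - _)]addrC subrK hK => near.
  have {}near : mdist (phi (g v - (tau + duration A)) x) (phi v z) <= e.
    by apply: near; move: t0_ge0; lra.
  have := le_trans (far _ r_ge) (metric_triangle _ (phi v z) _).
  by move: e_le_eta; lra.
Qed.

End Horseshoe.

(** * Minimality of the chain-recurrent classes *)

Section ZeroEntropy.
Context {R : realType} {X : metricType R}.
Variable phi : R -> X -> X.
Hypotheses (X_compact : compact [set: X]) (phi_flow : is_flow phi).
Hypotheses (phi_shadowing : standard_shadowing phi).
Hypotheses (phi_entropy : flow_entropy phi = 0%E).

Lemma iter_flow1 n z : iter n (phi 1) z = phi n%:R z.
Proof.
have [_ phi0 phiD] := phi_flow.
elim: n => [|n IH]; first by rewrite phi0.
by rewrite iterS IH -phiD -natr1 addrC.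
Qed.

(** Closeness at integer times spreads over unit intervals by equicontinuity. *)
Lemma bowen_shadows (e eta : R) n z z' :
    (forall t x y, 0 <= t <= 1 -> mdist x y <= e ->
       mdist (phi t x) (phi t y) < eta) ->
    bowen_dist (phi 1) n z z' <= e -> shadows phi eta n%:R z z'.
Proof.
move=> equi zz' v /andP[v0 vn]; have [_ _ phiD] := phi_flow.
have /andP[kv vk] := truncn_itv v0; set k := Num.truncn v in kv vk.
have := equi (v - k%:R) (phi k%:R z) (phi k%:R z').
rewrite -!phiD subrK => close; apply/ltW/close.
  by rewrite subr_ge0 kv /= lerBlDl natr1 ltW.
rewrite -!iter_flow1; apply: bowen_dist_ge zz'.
by rewrite -(ltr_nat R); exact: le_lt_trans vn.
Qed.

Lemma class_returns x q : CR phi x ->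
  chain_attainable phi x q -> chain_attainable phi q x -> returns phi x q.
Proof.
move=> xCR xq qx e t1 e0.
apply: contrapT => no_return.
(* The factor 5 leaves [4 * eta] for the tracing orbit, whose error is at most eta. *)
pose t0 := Num.max 0 t1; pose eta := e / 5.
have t00 : 0 <= t0 by rewrite le_max lexx.
have eta0 : 0 < eta by rewrite divr_gt0.
have far t : t0 <= t -> 5 * eta <= mdist (phi t x) q.
  rewrite ge_max => /andP[_ t1t]; rewrite leNgt; apply/negP => near.
  by apply: no_return; exists t => //; apply: lt_le_trans near _; rewrite /eta; lra.
have [rho rho0 equi] := flow_equicontinuous phi X_compact phi_flow 0 1 eta eta0.
pose eps := Num.min eta (1 / 2).
have eps0 : 0 < eps by rewrite lt_min eta0 divr_gt0.
have [eps_eta eps2] : eps <= eta /\ eps <= 1 / 2 by rewrite !ge_min !lexx orbT.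
have [d d0 shadow] := phi_shadowing eps eps0.
have [k xk] := omega_nonempty phi X_compact x.
have kq : chain_attainable phi k q.
  apply: attainable_trans xq.
  exact: returns_attainableV X_compact phi_flow _ _ xCR xk.
have /chain_inP[A [A0 startA] cA] := qx d d0.
have /chain_inP[B [B0 startB] cB] := kq d d0.
pose T := overhead t0 A B.
have dA := chain_duration_ge0 _ _ _ _ cA; have dB := chain_duration_ge0 _ _ _ _ cB.
have T0 : 0 <= T by rewrite /T !addr_ge0.
(* The waiting times are chosen after the connecting chains: the two letters then
   remain distinguishable after any reparametrization by a factor in [1/2, 2]. *)
have [m0 m0_ge m0k] := xk d (1 + 8 * T) d0.
have [m1 m1_ge m1k] := xk d (1 + 8 * T + 4 * (m0 + T)) d0.
pose m b := if b then m1 else m0.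
have m_ge b : 1 + 8 * T <= m b by case: b => //=; lra.
have m1_gt b : 1 <= m b by have := m_ge b; lra.
have jump b : mdist (phi (m b) x) (start B q) <= d.
  by rewrite startB; case: b; rewrite ltW.
pose ell := excursion_length A B m.
have ell_ge b : 8 * T <= ell b.
  by rewrite /ell /excursion_length; have := m_ge b; lra.
have gap : 8 * T + 4 * ell false < ell true.
  by rewrite /ell /excursion_length /=; move: m1_ge; rewrite /T /overhead; lra.
have ell0 b : 0 <= ell b by have := ell_ge b; lra.
pose L := ell true.
have ellL b : ell b <= L by case: b => //; have := ell0 false; rewrite /L; lra.
(* Tracing the n + 1 excursions of [rcons w true] takes at most 2L each, hence time [n.+1 * c] in
   all. *)
have [c c0 cL] : exists2 c, (0 < c)%N & 2 * L <= c%:R.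
  by exists (Num.truncn (2 * L)).+1; rewrite // ltW// truncnS_gt.
have trace w : exists z : X, exists2 h, Rep eps h &
    forall s1 p s2, code x A B m (rcons w true) = s1 ++ p :: s2 ->
      forall r, 0 <= r <= p.2 ->
      mdist (phi r p.1) (phi (h (duration s1 + r)) z) <= eps.
  have : code x A B m (rcons w true) != [::].
    by apply: code_neq0; rewrite -size_eq0 size_rcons.
  have := code_chain phi d x q A B m startA cA cB m1_gt jump (rcons w true).
  case: (code _ _ _ _ _) => [//|p s] /= [<- cP] _.
  exact: cycle_traced shadow cP.
have [z zP] := boolp.choice trace.
have sep n w w' : size w = n -> size w' = n -> w != w' ->
    rho < bowen_dist (phi 1) (n.+1 * c) (z w) (z w').
  move=> szw szw' ww'; rewrite ltNge; apply/negP => zz'.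
  have itin v : size v = n -> exists2 u, u [::] = 0 &
      itinerary phi q eta T (n.+1 * c)%:R ell (z v) u (rcons v true).
    move=> szv; have [h hR tr] := zP v.
    exists (h \o duration \o code x A B m).
      by have [_ _ h0 _] := hR; rewrite /= /duration big_nil.
    apply: (coded_itinerary phi phi_flow d eps eta t0 x q A B m A0 startA cA cB
      t00 m1_gt far eps_eta eps2 _ _ _ L _ hR tr ellL).
    by rewrite size_rcons szv mulrnAr natrM (mulr_natl c%:R) lerMn2r cL orbT.
  have [u u0 zu] := itin w szw; have [u' u'0 zu'] := itin w' szw'.
  move/eqP: ww'; apply.
  apply: (itinerary_inj phi q eta T _ ell eta0 ell_ge _ _ _ _ _ _ u0 u'0 T0 gap
    _ zu zu' (bowen_shadows _ _ _ _ _ equi zz')).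
  by rewrite szw.
have := topological_entropy_gt0 (phi 1) rho c z rho0 c0 sep.
by rewrite -/(flow_entropy phi) phi_entropy ltxx.
Qed.

(** Zero entropy puts C inside the limit set of x; conversely, a limit point of a chain-recurrent
    point is in its class. *)
Lemma chain_class_returns C x : chain_class phi C -> C x ->
  C = [set y | returns phi x y].
Proof.
move=> [x0 x0CR ->] [xCR x0x xx0]; apply/seteqP; split=> y /=.
  move=> [yCR x0y yx0]; apply: class_returns => //.
    exact: attainable_trans xx0 x0y.
  exact: attainable_trans yx0 x0x.
move=> xy; have xy' := returns_attainable phi x y xy.
have yx : chain_attainable phi y x by exact: returns_attainableV xy.
by split; [exact: attainable_trans yx xy'
  | exact: attainable_trans x0x xy' | exact: attainable_trans yx xx0].
Qed.

Lemma chain_class_minimal C : chain_class phi C -> minimal_set phi C.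
Proof.
move=> CC; have [_ phi0 phiD] := phi_flow.
have [x Cx] : C !=set0 by case: CC => x xCR ->; exists x.
have CE y : C y -> C = [set z | returns phi y z] by exact: chain_class_returns.
have inv t y : C y -> C (phi t y).
  by rewrite (CE x Cx) => ?; exact: returns_flow.
split=> [|t|y Cy z].
- apply: subclosed_compact X_compact (subsetT _).
  by rewrite (CE x Cx); exact: closed_returns.
- apply/seteqP; split=> [_ [y Cy <-]|y Cy]; first exact: inv.
  by exists (phi (- t) y); [exact: inv|rewrite -phiD subrr phi0].
- by rewrite {1}(CE y Cy); exact: returns_dense.
Qed.

Lemma chain_class_transitive C : chain_class phi C -> chain_transitive phi C.
Proof.
move=> CC x y Cx Cy d d0; have xy : returns phi x y.
  by move: Cy; rewrite (chain_class_returns C x CC Cx).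
(* A single orbit piece of x ending near y is a chain, and its two listed points x and y lie in
   C. *)
have [t t1 txy] := xy d 1 d0.
exists 1%N, (fun i => if i == 0 then x else y), (fun=> t); split=> // [|i _].
  split=> // i /= /andP[i0 i1] /andP[_ i2].
  by rewrite (_ : i = 0) /= ?ltW//; lia.
by case: ifP.
Qed.

End ZeroEntropy.

Theorem theorem3 (R : realType) (X : metricType R) (phi : R -> X -> X)
    (X_compact : compact [set: X]) (phi_flow : is_flow phi)
    (phi_shadowing : standard_shadowing phi)
    (phi_entropy : flow_entropy phi = 0%E) :
  [/\ forall C : set X, chain_class phi C -> nontrivial phi C ->
        almost_heteroclinic phi C /\ irreducible_set phi C,
      forall C : set X, chain_class phi C -> nontrivial phi C ->
        C `&` Sing phi = set0 -> minimal_set phi C &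
      Sing phi = set0 ->
        exists F : set (set X),
          [/\ forall K : set X, F K -> minimal_set phi K,
              trivIset F id &
              CR phi = \bigcup_(K in F) K] ].
Proof.
have minimal : forall C, chain_class phi C -> minimal_set phi C.
  exact: chain_class_minimal.
split=> [C CC _|C CC _ _|_]; [|exact: minimal|].
- have [cptC invC denseC] := minimal C CC; split.
    split=> //; first exact: chain_class_transitive.
    (* In the minimal set C no orbit fails to be dense, which settles the clause on heteroclinic
       connections. *)
    by move=> x Cx _ /(_ (denseC x Cx)).
  move=> [K [KC [_ KSing] [cptK invK _ _]]]; case: KC => KC; apply.
  rewrite (_ : K = C) //; apply: minimal_sub (minimal C CC) _ _ _ _ => //.
  (* An empty K would be contained in [Sing phi], against non-triviality. *)
  by apply/set0P/negP => /eqP K0; apply: KSing; rewrite K0.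
exists (chain_class phi); split=> //.
(* Two classes with a common point x both equal the limit set of x. *)
- apply/trivIsetP => C D CC DD /eqP CD; apply/eqP/negPn/negP => /set0P[x [Cx Dx]].
  apply: CD; rewrite (chain_class_returns phi _ _ _ _ C x)//.
  by rewrite -(chain_class_returns phi _ _ _ _ D x).
- apply/seteqP; split=> [x xCR|x [_ [y _ ->] []//]].
  by exists [set y | [/\ CR phi y, chain_attainable phi x y &
                      chain_attainable phi y x]]; [exists x|].
Qed.
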